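(* For every graph $G$ with maximum degree $\Delta$, \[ \chi'_D(G)\le \left\lfloor\frac{9}{16}\Delta^2+\frac{1}{2}\Delta\right\rfloor . \]
   Context: All graphs are finite and simple. A diamond is the graph on four vertices with exactly five edges (i.e. $K_4$ minus one edge); a diamond subgraph of $G$ is a (not necessarily induced) subgraph of $G$ isomorphic to the diamond. In an edge-colored graph, a subgraph is rainbow if all of its edges have pairwise distinct colors. A D-coloring of $G$ is a proper edge coloring of $G$ (edges sharing an endpoint get different colors) such that every diamond subgraph of $G$ is rainbow. The D-chromatic index $\chi'_D(G)$ is the minimum number of colors needed for a D-coloring of $G$. *)

(* Defs.v *)
From mathcomp Require Import all_boot all_order all_algebra.

Set Implicit Arguments.
Unset Strict Implicit.
Unset Printing Implicit Defensive.

Record sgraph := SGraph {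
  vertex :> finType;
  adj : rel vertex;
  adj_sym : symmetric adj;
  adj_irrefl : irreflexive adj }.

Definition edges (G : sgraph) : {set {set G}} :=
  [set [set p.1; p.2] | p in [pred p : G * G | adj p.1 p.2]].

Definition edge (G : sgraph) := {e : {set G} | e \in edges G}.

Definition degree (G : sgraph) (x : G) : nat := #|[set y | adj x y]|.

Definition max_degree (G : sgraph) : nat := \max_(x : G) degree x.

(* A subgraph is given by its vertex set W and its edge set F. *)
Definition is_subgraph (G : sgraph) (W : {set G}) (F : {set {set G}}) : bool :=
  (F \subset edges G) && [forall e in F, e \subset W].

Definition isomorphic_to (H G : sgraph) (W : {set G}) (F : {set {set G}}) :
    bool :=
  [exists f : {ffun H -> G},
    [&& injectiveb f, f @: [set: H] == W
      & [set f @: (e : {set H}) | e in edges H] == F]].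

(* K_4 on {0, 1, 2, 3} without the edge {2, 3}. *)
Definition diamond_adj : rel 'I_4 := fun x y => (x != y) && (minn x y < 2).

Lemma diamond_adj_sym : symmetric diamond_adj.
Proof. by move=> x y; rewrite /diamond_adj eq_sym minnC. Qed.

Lemma diamond_adj_irrefl : irreflexive diamond_adj.
Proof. by move=> x; rewrite /diamond_adj eqxx. Qed.

Definition diamond : sgraph := SGraph diamond_adj_sym diamond_adj_irrefl.

Definition proper_coloring (G : sgraph) (k : nat) (c : {ffun edge G -> 'I_k}) : bool :=
  [forall e, forall e',
    (e != e') && (val e :&: val e' != set0) ==> (c e != c e')].

Definition rainbow (G : sgraph) (k : nat) (c : {ffun edge G -> 'I_k})
    (F : {set {set G}}) : bool :=
  [forall e, forall e',
    [&& val e \in F, val e' \in F & e != e'] ==> (c e != c e')].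

Definition D_coloring (G : sgraph) (k : nat) (c : {ffun edge G -> 'I_k}) :
    bool :=
  proper_coloring c &&
  [forall W : {set G}, forall F : {set {set G}},
    is_subgraph W F && isomorphic_to diamond W F ==> rainbow c F].

Definition D_colorable (G : sgraph) (k : nat) : bool :=
  [exists c : {ffun edge G -> 'I_k}, D_coloring c].

Lemma D_colorable_ex (G : sgraph) : exists k, D_colorable G k.
Proof.
exists #|{: edge G}|; apply/existsP; exists [ffun e => enum_rank e].
apply/andP; split.
  apply/forallP=> e; apply/forallP=> e'; apply/implyP=> /andP[ne _].
  by rewrite !ffunE (inj_eq enum_rank_inj).
apply/forallP=> W; apply/forallP=> F; apply/implyP=> _.
apply/forallP=> e; apply/forallP=> e'; apply/implyP=> /and3P[_ _ ne].
by rewrite !ffunE (inj_eq enum_rank_inj).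
Qed.

Definition D_chromatic_index (G : sgraph) : nat := ex_minn (D_colorable_ex G).

(* Main.v *)
Require Import Defs.
From mathcomp Require Import all_boot all_order all_algebra.
From mathcomp Require Import zify lra.

Set Implicit Arguments.
Unset Strict Implicit.
Unset Printing Implicit Defensive.

Import GRing.Theory Num.Theory.
Local Open Scope ring_scope.

(** Colour the edges greedily.  Let [e = uv], let [T] be the set of the [t]
common neighbours of [u] and [v], and let [S] be the set of the vertices other
than [u], [v] adjacent to exactly one of them.  An edge disjoint from [e] that
shares a diamond with [e] joins a vertex of [T] to a vertex of [T] or [S].
If there are [N] such edges then [2 N] is at most the sum of the degrees in
[T :|: S] of the vertices of [T], plus the number of edges between [T] and [S],
i.e. at most [t (Delta - 2) + t (2 Delta - 2 - 2 t)].  Maximizing over [t] gives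
[N <= (3 Delta / 4 - 1) ^ 2]; adding the [2 (Delta - 1)] edges that meet [e],
fewer than [9/16 Delta ^ 2 + Delta / 2] edges conflict with [e]. *)

(** * Greedy colouring of a conflict relation *)

Lemma greedy_coloring (T : finType) (r : rel T) (k : nat) :
    symmetric r ->
    (forall x, #|[set y | (y != x) && r x y]| < k)%N ->
  exists c : {ffun T -> 'I_k}, forall x y, x != y -> r x y -> c x != c y.
Proof.
(* On an empty type [k] may be 0, so no default colour is available and this case is treated
   apart. *)
move=> rC rk; have [/card0_eq T0|/card_gt0P[x0 _]] := posnP #|T|.
  suff c (x : T) : 'I_k by exists (finfun c) => x; have := T0 x.
  by have := T0 x.
have k0 : (0 < k)%N := leq_ltn_trans (leq0n _) (rk x0).
suff /(_ (enum T)) [c cP] : forall s : seq T, exists c : {ffun T -> 'I_k},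
    {in s &, forall x y, x != y -> r x y -> c x != c y}.
  by exists c => x y; apply: cP; rewrite mem_enum.
elim=> [|x s [c cP]]; first by exists [ffun=> Ordinal k0].
(* Since [c] is total, [a] can avoid the colours of all neighbours of [x], including the arbitrary
   values outside [s]: fewer than [k] colours are excluded anyway. *)
have [a aP] : exists a, a \notin c @: [set y | (y != x) && r x y].
  apply/existsP; rewrite -negb_forall; apply/negP => /forallP im.
  have := leq_trans (leq_ltn_trans (leq_imset_card c _) (rk x)) _.
  move=> /(_ _ (leqnn k)); rewrite -[X in (_ < X)%N](card_ord k) ltnNge.
  by move/negP; apply; apply/subset_leq_card/subsetP => a _.
have aN y : y != x -> r x y -> c y != a.
  by move=> yx rxy; apply: contraNneq aP => <-; rewrite imset_f // inE yx.
exists [ffun y => if y == x then a else c y] => y z.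
rewrite !inE !ffunE; have [->|yx] := eqVneq y x; have [->|zx] := eqVneq z x.
- by rewrite eqxx.
- by move=> _ _ _ /(aN _ zx); rewrite eq_sym.
- by move=> _ _ _; rewrite rC => /(aN _ yx).
- exact: cP.
Qed.

(** * Disjoint edges of a diamond *)

Lemma edgesP (G : sgraph) (e : {set G}) :
  reflect (exists x y, adj x y /\ e = [set x; y]) (e \in edges G).
Proof.
apply: (iffP imsetP) => [[[x y] /= xy ->]|[x [y [xy ->]]]].
  by exists x, y.
by exists (x, y).
Qed.

(** The four ends exhaust the diamond, so its one missing edge is among the four cross pairs. Hence
    one end of [kl] sees both [i] and [j], and the other sees at least one of them. *)
Lemma diamond_disjoint_edges (i j k l : diamond) :
    adj i j -> adj k l -> i != k -> i != l -> j != k -> j != l ->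
  [&& adj i k, adj j k & adj i l || adj j l]
  || [&& adj i l, adj j l & adj i k || adj j k].
Proof.
by case: i => [[|[|[|[|?]]]] ?] //; case: j => [[|[|[|[|?]]]] ?] //;
   case: k => [[|[|[|[|?]]]] ?] //; case: l => [[|[|[|[|?]]]] ?].
Qed.

Lemma edges2E (G : sgraph) (x y : G) : ([set x; y] \in edges G) = adj x y.
Proof.
apply/edgesP/idP => [[a [b [ab E]]]|xy]; last by exists x, y.
have ba : adj b a by rewrite adj_sym.
have aN : a != b by apply: contraTneq ab => ->; rewrite adj_irrefl.
have : x \in [set a; b] by rewrite -E set21.
have : y \in [set a; b] by rewrite -E set22.
have : a \in [set x; y] by rewrite E set21.
have : b \in [set x; y] by rewrite E set22.
rewrite !inE => bxy axy /orP[]/eqP yE /orP[]/eqP xE; subst x y => //.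
- by move: bxy; rewrite orbb eq_sym (negPf aN).
- by move: axy; rewrite orbb (negPf aN).
Qed.

Lemma edge_subgraph_diamond (G : sgraph) (phi : diamond -> G) (i j : diamond) :
    [set phi @: (e : {set diamond}) | e in edges diamond] \subset edges G ->
  adj i j -> adj (phi i) (phi j).
Proof.
move=> /subsetP phiG ij; rewrite -edges2E; apply: phiG.
apply/imsetP; exists [set i; j]; last by rewrite imsetU1 imset_set1.
by rewrite edges2E.
Qed.

Definition in_common_diamond (G : sgraph) (e f : {set G}) : bool :=
  [exists W : {set G}, exists F : {set {set G}},
    [&& is_subgraph W F, isomorphic_to diamond W F, e \in F & f \in F]].

(** The embedding [phi] carries the adjacencies of [diamond_disjoint_edges] to [G]; [x] is the end
    of [f] joined to both ends of [e]. *)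
Lemma common_diamond_disjoint (G : sgraph) (e f : {set G}) :
    in_common_diamond e f -> e :&: f = set0 ->
  exists x y, [/\ f = [set x; y], adj x y, {in e, forall w, adj w x}
                & exists2 w, w \in e & adj w y].
Proof.
move=> /existsP[W /existsP[F /and4P[/andP[FG _] /existsP[phi /and3P[_ _ /eqP FE]]]]].
rewrite -FE in FG *; move=> /imsetP[_ /edgesP[i [j [ij ->]]] eE].
move=> /imsetP[_ /edgesP[k [l [kl ->]]] fE] ef0.
have phiG a b := @edge_subgraph_diamond G phi a b FG.
rewrite !imsetU1 !imset_set1 in eE fE.
have ne a b : phi a \in e -> phi b \in f -> a != b.
  move=> ae bf; apply: contra_eqN ef0 => /eqP ab; apply/set0Pn; exists (phi a).
  by rewrite inE ae ab.
have [ie je] : phi i \in e /\ phi j \in e by rewrite eE set21 set22.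
have [kf lf] : phi k \in f /\ phi l \in f by rewrite fE set21 set22.
have := diamond_disjoint_edges ij kl (ne _ _ ie kf) (ne _ _ ie lf)
  (ne _ _ je kf) (ne _ _ je lf).
move=> /orP[] /and3P[ik jk ijl].
  exists (phi k), (phi l); split => //; first exact: phiG.
    by move=> w; rewrite eE !inE => /orP[]/eqP->; apply: phiG.
  by case/orP: ijl => ?; [exists (phi i)|exists (phi j)] => //; apply: phiG.
exists (phi l), (phi k); split; first by rewrite fE setUC.
- by apply: phiG; rewrite adj_sym.
- by move=> w; rewrite eE !inE => /orP[]/eqP->; apply: phiG.
by case/orP: ijl => ?; [exists (phi i)|exists (phi j)] => //; apply: phiG.
Qed.

(** * Neighbourhoods of an edge and edge counts *)

Definition common_nbrs (G : sgraph) (u v : G) : {set G} :=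
  [set x | adj u x && adj v x].

(** When [uv] is an edge, the exclusive or holds at [u] and at [v] themselves, hence their explicit
    exclusion. *)
Definition private_nbrs (G : sgraph) (u v : G) : {set G} :=
  [set x | [&& x != u, x != v & adj u x (+) adj v x]].

Definition edges_between (G : sgraph) (A B : {set G}) : {set {set G}} :=
  [set [set p.1; p.2] | p in [pred p : G * G | [&& p.1 \in A, p.2 \in B & adj p.1 p.2]]].

(** A sum of indicators, so that degree counts can be compared vertex by vertex. *)
Definition degree_in (G : sgraph) (A : {set G}) (x : G) : nat :=
  \sum_(y in A) adj x y.

Lemma edges_betweenP (G : sgraph) (A B : {set G}) (f : {set G}) :
  reflect (exists x y, [/\ x \in A, y \in B, adj x y & f = [set x; y]])
          (f \in edges_between A B).
Proof.
apply: (iffP imsetP) => [[[x y] /= /and3P[xA yB xy] ->]|[x [y [xA yB xy ->]]]].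
  by exists x, y.
by exists (x, y) => //=; apply/and3P.
Qed.

Lemma card_arcs_between (G : sgraph) (A B : {set G}) :
  #|[pred p : G * G | [&& p.1 \in A, p.2 \in B & adj p.1 p.2]]|
    = (\sum_(x in A) degree_in B x)%N.
Proof.
rewrite /degree_in pair_big -sum1_card big_mkcond [RHS]big_mkcond /=.
apply: eq_bigr => -[x y] _; rewrite inE /=.
by case: (x \in A); case: (y \in B); case: (adj x y).
Qed.

Lemma card_edges_between (G : sgraph) (A B : {set G}) :
  (#|edges_between A B| <= \sum_(x in A) degree_in B x)%N.
Proof. by rewrite -card_arcs_between leq_imset_card. Qed.

(** Grouping the arcs by underlying edge, each fibre contains both orientations, which differ
    because [adj] is irreflexive. *)
Lemma card_edges_within (G : sgraph) (A : {set G}) :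
  (2 * #|edges_between A A| <= \sum_(x in A) degree_in A x)%N.
Proof.
rewrite -card_arcs_between mulnC -sum_nat_const -[leqRHS]sum1_card.
rewrite (partition_big_imset (fun p : G * G => [set p.1; p.2])) /=.
apply: leq_sum => f /edges_betweenP[x [y [xA yA xy ->]]].
rewrite sum1dep_card; have xyN : x != y.
  by apply: contraTneq xy => ->; rewrite adj_irrefl.
have <- : #|[set (x, y); (y, x)]| = 2%N.
  by rewrite cards2 -pair_eqE /= negb_and xyN.
apply/subset_leq_card/subsetP => p; rewrite !inE => /orP[]/eqP-> /=.
  by rewrite xA yA xy eqxx.
by rewrite xA yA adj_sym xy setUC eqxx.
Qed.

Lemma degreeE (G : sgraph) (x : G) : degree x = (\sum_y adj x y)%N.
Proof.
rewrite /degree -sum1_card big_mkcond; apply: eq_bigr => y _; rewrite inE.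
by case: adj.
Qed.

(** Spreads the constant 2 of the degree counts over the vertices, so that they reduce to a check at
    each vertex. *)
Lemma sum_eq2 (T : finType) (x y : T) : (\sum_z ((z == x) + (z == y)) = 2)%N.
Proof.
have sum_eq1 a : (\sum_(z : T) (z == a) = 1)%N.
  by rewrite (bigD1 a) //= eqxx big1 // => z /negPf->.
by rewrite big_split /= !sum_eq1.
Qed.

Lemma card_sum_mem (T : finType) (A : {set T}) : #|A| = (\sum_x (x \in A))%N.
Proof. by rewrite -sum1_card big_mkcond; apply: eq_bigr => x _; case: (x \in A). Qed.

Lemma degree_common_private (G : sgraph) (u v : G) : adj u v ->
  (degree u + degree v = 2 * #|common_nbrs u v| + #|private_nbrs u v| + 2)%N.
Proof.
move=> uv; rewrite mul2n -addnn !degreeE !card_sum_mem -(sum_eq2 u v) -!big_split /=.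
have uvN : u != v by apply: contraTneq uv => ->; rewrite adj_irrefl.
apply: eq_bigr => x _; rewrite !inE.
have [->|xu] := eqVneq x u.
  by rewrite adj_irrefl (adj_sym v u) uv (negPf uvN).
have [->|xv] := eqVneq x v; first by rewrite adj_irrefl uv.
by case: (adj u x); case: (adj v x).
Qed.

(** Common and private neighbours form disjoint sets that avoid [u] and [v]; these two neighbours of
    [x] give the 2. *)
Lemma degree_in_common (G : sgraph) (u v x : G) :
    u != v -> x \in common_nbrs u v ->
  (degree_in (common_nbrs u v) x + degree_in (private_nbrs u v) x + 2
     <= degree x)%N.
Proof.
move=> uv; rewrite inE => /andP[ux vx].
rewrite degreeE /degree_in ![\sum_(y in _) _]big_mkcond /=.
rewrite -(sum_eq2 u v) -!big_split /=.
apply: leq_sum => y _; rewrite !inE.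
have [->|yu] := eqVneq y u.
  by rewrite adj_irrefl (negPf uv) /= adj_sym ux.
have [->|yv] := eqVneq y v.
  by rewrite adj_irrefl andbF /= adj_sym vx.
by case: (adj u y); case: (adj v y); case: (adj x y).
Qed.

Lemma degree_in_le (G : sgraph) (A : {set G}) (x : G) : (degree_in A x <= #|A|)%N.
Proof. by rewrite -sum1_card; apply: leq_sum => y _; case: adj. Qed.

(** * Counting the conflicts of an edge *)

Definition conflict (G : sgraph) (e f : {set G}) : bool :=
  (e :&: f != set0) || in_common_diamond e f.

Lemma conflict_sub (G : sgraph) (u v : G) (f : {set G}) :
    adj u v -> f \in edges G -> f != [set u; v] -> conflict [set u; v] f ->
  f \in ([set [set u; y] | y in [set y | adj u y] :\ v]
         :|: [set [set v; y] | y in [set y | adj v y] :\ u])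
        :|: (edges_between (common_nbrs u v) (common_nbrs u v)
             :|: edges_between (common_nbrs u v) (private_nbrs u v)).
Proof.
move=> uv fG fN; rewrite /conflict; have [ef0 /= cf|ef _] := eqVneq (_ :&: f) set0.
  have [x [y [fE xy wx [w we wy]]]] := common_diamond_disjoint cf ef0.
  have xT : x \in common_nbrs u v by rewrite inE !wx ?set21 ?set22.
  have yN z : z \in [set u; v] -> y != z.
    move=> ze; apply: contra_eqN ef0 => /eqP yz; apply/set0Pn; exists y.
    by rewrite inE {1}yz ze fE set22.
  rewrite inE; apply/orP; right; rewrite inE.
  have [yT|yT] := boolP (y \in common_nbrs u v); apply/orP; [left|right];
    apply/edges_betweenP; exists x, y; split => //.
  (* Here [y] is adjacent to an end of the edge but not to both, so it is a private neighbour. *)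
  move: yT we wy; rewrite !inE !yN ?set21 ?set22 //= => yT.
  by case/orP => /eqP-> yw; move: yT; rewrite yw ?andbT //= ; case: adj.
case/set0Pn: ef => w; rewrite inE => /andP[we wf].
have {wf} [y [wy fE]] : exists y, adj w y /\ f = [set w; y].
  have /edgesP[a [b [ab fE]]] := fG; move: wf; rewrite fE !inE.
  case/orP => /eqP->; [by exists b|exists a].
  by rewrite adj_sym setUC.
rewrite inE; apply/orP; left; rewrite inE.
move: we; rewrite !inE => /orP[]/eqP wE; subst w; apply/orP; [left|right];
  (* The end [y] is not the other end of [uv], since [f] differs from that edge. *)
  apply/imsetP; exists y => //; rewrite !inE wy andbT;
  by apply: contraNneq fN => yE; rewrite fE yE // setUC.
Qed.

(* The deficit from the maximum is a multiple of [(3 D - 4 - 4 t) ^ 2]: the worst case is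
[t = 3 D / 4 - 1]. *)
Lemma conflict_arith (D d t s n m k a b : nat) :
    (n + 2 <= d + (m + k) -> d = 2 * t + s + 2 -> d <= 2 * D ->
     a + b + 2 * t <= t * D -> b <= t * s -> 2 * m <= a -> k <= b ->
  16 * n.+1 <= 9 * D ^ 2 + 8 * D)%N.
Proof.
move=> nd dE dD abD bs ma kb.
have ts : (t * (2 * t + s + 2) <= t * (2 * D))%N by rewrite leq_mul2l -dE dD orbT.
have sq : (0 <= (3 * D%:Z - 4 - 4 * t%:Z) ^+ 2) := sqr_ge0 _.
nia.
Qed.

(** The successor gives the strict inequality that the greedy colouring requires. *)
Lemma card_conflict (G : sgraph) (u v : G) (D : nat) :
    (forall x : G, degree x <= D)%N -> adj u v ->
  (16 * #|[set f in edges G | (f != [set u; v]) && conflict [set u; v] f]|.+1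
     <= 9 * D ^ 2 + 8 * D)%N.
Proof.
move=> degD uv; have uvN : u != v.
  by apply: contraTneq uv => ->; rewrite adj_irrefl.
set T := common_nbrs u v; set S := private_nbrs u v.
set N := (#|edges_between T T| + #|edges_between T S|)%N.
have cardC : (#|[set f in edges G | (f != [set u; v]) && conflict [set u; v] f]| + 2
              <= degree u + degree v + N)%N.
  have/subset_leq_card : [set f in edges G | (f != [set u; v]) && conflict [set u; v] f]
    \subset ([set [set u; y] | y in [set y | adj u y] :\ v]
         :|: [set [set v; y] | y in [set y | adj v y] :\ u])
        :|: (edges_between T T :|: edges_between T S).
    by apply/subsetP => f; rewrite inE => /and3P[*]; apply: conflict_sub.
  (* The edge [uv] is counted in both degrees; removing it twice accounts for the 2 in [cardC]. *)
  have -> : degree u = (#|[set y | adj u y] :\ v|).+1.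
    by rewrite /degree (cardsD1 v) inE uv.
  have -> : degree v = (#|[set y | adj v y] :\ u|).+1.
    by rewrite /degree (cardsD1 u) inE adj_sym uv.
  move=> /leq_trans; rewrite addn2 !(addSn, addnS) !ltnS; apply.
  apply: leq_trans (leq_card_setU _ _).1 _; apply: leq_add; last first.
    exact: (leq_card_setU _ _).1.
  apply: leq_trans (leq_card_setU _ _).1 _.
  by apply: leq_add; apply: leq_imset_card.
have degT : (\sum_(x in T) degree_in T x + \sum_(x in T) degree_in S x + 2 * #|T|
             <= #|T| * D)%N.
  rewrite [X in (_ + X)%N]mulnC -!sum_nat_const -!big_split /=; apply: leq_sum => x xT.
  exact: leq_trans (degree_in_common uvN xT) (degD x).
have degS : (\sum_(x in T) degree_in S x <= #|T| * #|S|)%N.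
  by rewrite -sum_nat_const; apply: leq_sum => x _; apply: degree_in_le.
have dD : (degree u + degree v <= 2 * D)%N by rewrite mul2n -addnn leq_add.
have dE := degree_common_private uv.
have eTT := card_edges_within T.
have eTS := card_edges_between T S.
rewrite -/T -/S in dE.
exact: conflict_arith cardC dE dD degT degS eTT eTS.
Qed.

(** * From conflicts to the chromatic index *)

Lemma D_chromatic_index_le (G : sgraph) (D : nat) :
  (forall x : G, degree x <= D)%N -> (D_chromatic_index G <= (9 * D ^ 2 + 8 * D) %/ 16)%N.
Proof.
move=> degD; rewrite /D_chromatic_index; case: ex_minnP => m _; apply.
pose r (e f : edge G) := conflict (val e) (val f).
have rC : symmetric r.
  move=> e f; rewrite /r /conflict setIC; congr (_ || _).
  by apply: eq_existsb => W; apply: eq_existsb => F; rewrite [(val e \in F) && _]andbC.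
have [|c cP] := @greedy_coloring _ r ((9 * D ^ 2 + 8 * D) %/ 16) rC.
  move=> e; have /edgesP[u [v [uv eE]]] := valP e.
  rewrite leq_divRL // mulnC; apply: leq_trans (card_conflict degD uv).
  (* The conflicts live in the subtype [edge G]; the injection [val] moves their count to sets of
     vertices. *)
  rewrite leq_mul2l ltnS -eE -(card_imset _ val_inj); apply/subset_leq_card/subsetP.
  by move=> _ /imsetP[f fP ->]; move: fP; rewrite !inE (valP f).
apply/existsP; exists c; apply/andP; split.
  apply/forallP => e; apply/forallP => f; apply/implyP => /andP[ef meet].
  by apply: cP => //; rewrite /r /conflict meet.
apply/forallP => W; apply/forallP => F; apply/implyP => /andP[sub iso].
apply/forallP => e; apply/forallP => f; apply/implyP => /and3P[eF fF ef].
apply: cP => //; apply/orP; right; apply/existsP; exists W; apply/existsP.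
by exists F; apply/and4P.
Qed.

Theorem theorem1p4 (G : sgraph) (Delta : nat) (hDelta : max_degree G = Delta) :
  (D_chromatic_index G)%:Z <=
    Num.floor ((9%:R / 16%:R) * Delta%:R ^+ 2 + (1 / 2%:R) * Delta%:R : rat).
Proof.
have degD (x : G) : (degree x <= Delta)%N by rewrite -hDelta; apply: leq_bigmax.
have := D_chromatic_index_le degD; rewrite leq_divRL // => le16.
(* An integer is at most the floor exactly when it is at most the number itself, so [le16] cast to
   the rationals suffices. *)
rewrite floor_ge_int.
have : ((D_chromatic_index G * 16)%:R <= (9 * Delta ^ 2 + 8 * Delta)%:R :> rat).
  by rewrite ler_nat.
rewrite natrD !natrM pmulrn; lra.
Qed.
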